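(* Let $h(n)$ be the height of the tower factorization of the positive integer $n$. For any integers $\ell\ge 2$ and $k\ge 2$, there exist infinitely many positive integers $n$ such that $h(n+j)\ge k$ for all $j=0,1,\ldots,\ell-1$.
   Context: Every integer $n\ge 2$ is written in canonical form $n=p_1^{a_1}\cdots p_r^{a_r}$ with primes $p_1<\cdots<p_r$ and positive integers $a_i$. Factoring each exponent larger than $1$ into prime powers, then doing the same with the new exponents, and so on, gives the tower factorization of $n$; its height $h(n)$ is the number of floors in it. Equivalently, $h(n)=1$ if and only if $n$ is square-free (in particular $h(1)=1$), and if $n$ is not square-free then $h(n)=1+\max\{h(a_i): a_i\ge 2\}$. For example, $h(p^2)=2$ for $p$ prime, and $h(2^{2^{2^2}})=4$. *)

(* Defs.v *)
From mathcomp Require Import all_boot.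
From mathcomp Require Import boolp classical_sets functions cardinality.

Set Implicit Arguments.
Unset Strict Implicit.
Unset Printing Implicit Defensive.

(* [Tower [:: (p1, t1); ...; (pr, tr)]] is the expression                     *)
(* p1 ^ t1 * ... * pr ^ tr, in which each exponent ti is itself a tower. The  *)
(* empty product [Tower [::]] is 1; in exponent position it is an exponent    *)
(* equal to 1, which is not factored further and takes up no floor.           *)
Inductive tower : Type := Tower of seq (nat * tower).

Fixpoint tower_val (t : tower) : nat :=
  let: Tower s := t in foldr (fun q m => q.1 ^ tower_val q.2 * m) 1 s.

Fixpoint floors (t : tower) : nat :=
  let: Tower s := t in foldr (fun q m => maxn (floors q.2).+1 m) 0 s.

(* The fuel [f] bounds the recursion depth; since [logn p n < n] for every    *)
(* prime factor p of n, any f >= n gives the same tower (see                  *)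
(* [tower_factorizationE]).                                                   *)
Fixpoint tower_fuel (f n : nat) : tower :=
  if f is f'.+1 then Tower [seq (p, tower_fuel f' (logn p n)) | p <- primes n]
  else Tower [::].

Definition tower_factorization (n : nat) : tower := tower_fuel n n.

(* [maxn 1] only matters for n = 1, where it gives the convention h(1) = 1,   *)
(* and for the meaningless value at n = 0.                                    *)
Definition height (n : nat) : nat := maxn 1 (floors (tower_factorization n)).

Definition squarefree (n : nat) : Prop := forall p, prime p -> ~~ (p ^ 2 %| n).

Lemma logn_ltn (p n : nat) : p \in primes n -> logn p n < n.
Proof.
rewrite mem_primes => /and3P[p_pr n0 _].
apply: leq_trans (ltn_expl _ (prime_gt1 p_pr)) _.
by apply: dvdn_leq => //; apply: pfactor_dvdnn.
Qed.

Lemma tower_fuel_irr (f g n : nat) :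
  n <= f -> n <= g -> tower_fuel f n = tower_fuel g n.
Proof.
elim: f g n => [|f IHf] [|g] [|n] //= nf ng.
congr Tower; apply/eq_in_map => p /logn_ltn lt_pn.
by congr pair; apply: IHf; rewrite -ltnS; apply: leq_trans lt_pn _.
Qed.

Lemma tower_factorizationE (n : nat) :
  tower_factorization n =
  Tower [seq (p, tower_factorization (logn p n)) | p <- primes n].
Proof.
case: n => [|n] //; rewrite {1}/tower_factorization /=.
congr Tower; apply/eq_in_map => p /logn_ltn lt_pn.
by congr pair; apply: tower_fuel_irr.
Qed.

Lemma tower_factorizationK (n : nat) :
  0 < n -> tower_val (tower_factorization n) = n.
Proof.
elim/ltn_ind: n => n IHn n0; rewrite tower_factorizationE /=.
rewrite foldr_map /= [RHS]prod_prime_decomp // prime_decompE big_map /=.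
have sub : {subset primes n <= primes n} by [].
rewrite unlock /reducebig /=; elim: {1 3 4}(primes n) sub => //= p s IHs sub.
have ps : p \in primes n by apply: sub; rewrite mem_head.
rewrite IHn ?logn_ltn ?logn_gt0 // IHs // => q qs.
by apply: sub; rewrite inE qs orbT.
Qed.

Lemma floorsE (n : nat) :
  floors (tower_factorization n) =
  \max_(p <- primes n) (floors (tower_factorization (logn p n))).+1.
Proof. by rewrite tower_factorizationE /= foldr_map unlock. Qed.

Lemma floors_height (n : nat) :
  1 < n -> floors (tower_factorization n) = height n.
Proof.
move=> n1; apply/esym/maxn_idPr; rewrite floorsE.
by rewrite (bigD1_seq (pdiv n)) ?primes_uniq ?leq_max //= mem_primes pdiv_prime
  // pdiv_dvd ltnW.
Qed.

Lemma height_squarefree (n : nat) : 0 < n -> height n = 1 <-> squarefree n.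
Proof.
move=> n0; split=> [h1 p p_pr | sqf].
  apply/negP; rewrite pfactor_dvdn // => e2.
  have pn : p \in primes n by rewrite -logn_gt0 ltnW.
  suff: 2 <= height n by rewrite h1.
  rewrite leq_max floorsE (bigD1_seq p) ?primes_uniq //= leq_max.
  by rewrite ltnS floors_height // leq_max.
apply/maxn_idPl; rewrite floorsE; apply/bigmax_leqP_seq => p pn _.
have := sqf p; rewrite ltnS.
move: (pn); rewrite mem_primes => /and3P[p_pr _ _] /(_ p_pr).
rewrite pfactor_dvdn // -leqNgt => le1.
by move: pn le1; rewrite -logn_gt0; case: (logn p n) => [|[]].
Qed.

Lemma height_nsquarefree (n : nat) : 0 < n -> ~ squarefree n ->
  height n = (\max_(p <- primes n | 2 <= logn p n) height (logn p n)).+1.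
Proof.
move=> n0 nsqf.
have h1 : height n <> 1 by move=> /(height_squarefree n0).
have n1 : 1 < n by case: n n0 h1 {nsqf} => [|[]].
have h2 : 1 < height n by rewrite ltn_neqAle leq_max andbT eq_sym; apply/eqP.
apply/eqP; rewrite eqn_leq; apply/andP; split.
  rewrite -{1}floors_height // floorsE; apply/bigmax_leqP_seq => p pn _.
  rewrite ltnS; have [e2|] := leqP 2 (logn p n).
    by rewrite floors_height // (@leq_bigmax_seq _ _ _ (fun p => height (logn p n))).
  by move: pn; rewrite -logn_gt0; case: (logn p n) => [|[]].
rewrite -(ltn_predK h2) ltnS; apply/bigmax_leqP_seq => p pn e2.
rewrite -ltnS (ltn_predK h2) -(floors_height n1) floorsE.
rewrite -floors_height //.
exact: (@leq_bigmax_seq _ _ _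
  (fun p => (floors (tower_factorization (logn p n))).+1)).
Qed.

(* Main.v *)
Require Import Defs.
From mathcomp Require Import all_boot.
From mathcomp Require Import boolp classical_sets functions cardinality.

(** If a prime [p] divides [n] exactly [e >= 1] times, the tower of [n] has at
    least one floor more than that of [e]. Fix an exponent [e >= 1] with at least
    [k - 1] floors, such as an iterated power of 2. Requiring
    [n + j = p ^ e] modulo [p ^ (e + 1)] forces [logn p (n + j) = e], hence
    [height (n + j) >= k]. With a different prime for each [j < l] these
    congruences are compatible by the Chinese remainder theorem, and the
    solutions fill an arithmetic progression ([high_run_progression]), which is
    an infinite set. *)

Local Open Scope classical_set_scope.

Lemma floors_logn_lt (p n : nat) : p \in primes n ->
  floors (tower_factorization (logn p n)) < floors (tower_factorization n).
Proof.
move=> pn; rewrite [X in _ < X]floorsE.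
exact: (@leq_bigmax_seq _ _ _
  (fun q => (floors (tower_factorization (logn q n))).+1)).
Qed.

Lemma exists_many_floors (k : nat) :
  exists2 e, 0 < e & k <= floors (tower_factorization e).
Proof.
elim: k => [|k [e e0 ke]]; first by exists 1.
exists (2 ^ e); first by rewrite expn_gt0.
have e2 : logn 2 (2 ^ e) = e by apply: pfactorK.
apply: leq_ltn_trans ke _.
by rewrite -{1}e2; apply: floors_logn_lt; rewrite -logn_gt0 e2.
Qed.

Lemma logn_eqmod (p e a : nat) : prime p ->
  a = p ^ e %[mod p ^ e.+1] -> logn p a = e.
Proof.
move=> p_pr ae.
have dvdE d : d <= e.+1 -> (p ^ d %| a) = (d <= e).
  move=> de; have pd : p ^ d %| p ^ e.+1 by apply: dvdn_exp2l.
  by rewrite /dvdn -(modn_dvdm a pd) ae modn_dvdm // -/(dvdn _ _)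
    dvdn_Pexp2l // prime_gt1.
have a0 : 0 < a by case: a dvdE {ae} => // /(_ e.+1 (leqnn _)); rewrite dvdn0 ltnn.
apply/eqP; rewrite eqn_leq -pfactor_dvdn // dvdE // leqnn andbT.
by rewrite leqNgt -pfactor_dvdn // dvdE // ltnn.
Qed.

(** The modulus [M] gathers the prime powers used for the indices below [l], so
    any prime larger than [M] is a new one. *)
Lemma high_run_progression (k l : nat) : exists M c : nat, 0 < M /\
  forall x, x = c %[mod M] -> forall j, j < l -> k <= height (x + j).
Proof.
have [e e0 ke] := exists_many_floors k.-1.
elim: l => [|l [M [c [M0 IHl]]]]; first by exists 1, 0.
have [p ltMp p_pr] := prime_above M.
have p0 := prime_gt0 p_pr.
have coMp : coprime M (p ^ e.+1).
  by rewrite coprime_sym coprimeXl // prime_coprime // gtnNdvd.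
(* [r + l] is congruent to [p ^ e] modulo [p ^ e.+1]. *)
pose r := p ^ e + (p ^ e.+1).-1 * l.
exists (M * p ^ e.+1), (chinese M (p ^ e.+1) c r).
split=> [|x xE j]; first by rewrite muln_gt0 M0 expn_gt0 p0.
rewrite ltnS leq_eqVlt => /predU1P[->|]; last first.
  apply: IHl; rewrite -(chinese_modl coMp c r).
  by rewrite -(modn_dvdm x (dvdn_mulr (p ^ e.+1) (dvdnn M))) xE modn_dvdm
    ?dvdn_mulr.
have xr : x = r %[mod p ^ e.+1].
  rewrite -(chinese_modr coMp c r).
  by rewrite -(modn_dvdm x (dvdn_mull M (dvdnn (p ^ e.+1)))) xE modn_dvdm
    ?dvdn_mull.
have xl : logn p (x + l) = e.
  apply: logn_eqmod => //; rewrite -modnDml xr modnDml /r -addnA -mulSnr.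
  by rewrite prednK ?expn_gt0 ?p0 // addnC mulnC modnMDl.
have := @floors_logn_lt p (x + l); rewrite -logn_gt0 xl => /(_ e0) lt_e.
rewrite /height leq_max; apply/orP; right.
exact: leq_trans (leqSpred k) (leq_ltn_trans ke lt_e).
Qed.

Lemma unbounded_infinite (A : set nat) :
  (forall N, exists2 n, N < n & A n) -> infinite_set A.
Proof.
move=> unbA /finite_seqP[s As].
have [n ltsn] := unbA (\max_(x <- s) x).
rewrite As /= => ns; move: ltsn; rewrite ltnNge => /negP; apply.
exact: (@leq_bigmax_seq _ _ _ id).
Qed.

Theorem mainTheorem3 (l k : nat) (hl : 2 <= l) (hk : 2 <= k) :
  infinite_set
    [set n : nat | 0 < n /\ forall j : nat, j < l -> k <= height (n + j)].
Proof.
have [M [c [M0 Mc]]] := high_run_progression k l.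
apply: unbounded_infinite => N; exists (N.+1 * M + c).
  by rewrite ltn_addr // leq_pmulr.
split; first by rewrite addn_gt0 muln_gt0 M0.
by apply: Mc; rewrite modnMDl.
Qed.
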